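(* Let $n\ge1$, let $k\in\mathbf Z$ satisfy $k\ge\frac n2$, and let $\Gamma\subset\mathrm{Sp}_n(\mathbf Z)$ be any congruence subgroup. Assume that there is $\alpha\ge0$ depending only on $n$ such that $$\sup(S^{(n)}_\kappa(\Gamma))\ll_n\kappa^{2\alpha}\qquad\text{for all integers }\kappa\gg_n1,$$ where the implied constant depends (besides $n$) only on the complementary set of parameters: on $\Gamma$ if one considers the weight aspect, on the weight if one considers the level aspect, and on neither in the hybrid aspect (in the hybrid aspect one takes $\alpha=0$). Then for any $L^2$-normalised $G\in S^{(n)}_k(\Gamma)$ one has $$\|G\|_\infty\ll_n k^\alpha,$$ where again the implied constant in each case depends (besides $n$) only on the complementary set of parameters.
   Context: $\mathbf H_n$ is the Siegel upper half space of complex symmetric $n\times n$ matrices $Z=X+iY$ with $Y>0$; $\mathrm{Sp}_n(\mathbf Z)\subset\mathrm{GL}_{2n}(\mathbf Z)$ is the Siegel modular group of degree $n$. A congruence subgroup is a subgroup containing the principal congruence subgroup of some level. $S^{(n)}_k(\Gamma)$ is the space of holomorphic Siegel cusp forms of degree $n$ and weight $k$ on $\Gamma$, with (not volume normalized) Petersson inner product $\langle F,H\rangle=\int_{\Gamma\backslash\mathbf H_n}F(Z)\overline{H(Z)}\det(Y)^k\,d\mu(Z)$, $d\mu(Z)=\det(Y)^{-(n+1)}dX\,dY$; $L^2$-normalised means $\langle G,G\rangle=1$. $\|G\|_\infty=\sup_{Z\in\mathbf H_n}\det(Y)^{k/2}|G(Z)|$. For an orthonormal basis $B_\kappa(\Gamma)$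 of $S^{(n)}_\kappa(\Gamma)$, $\sup(S^{(n)}_\kappa(\Gamma))=\sup_{Z\in\mathbf H_n}\sum_{F\in B_\kappa(\Gamma)}\det(Y)^\kappa|F(Z)|^2$. ''For all $\kappa\gg_n1$'' means for all $\kappa\ge\kappa_0$ with $\kappa_0$ depending only on $n$. *)

(* Defs.v *)
From HB Require Import structures.
From mathcomp Require Import all_boot all_order all_algebra.
From mathcomp Require Import complex.
From mathcomp Require Import all_classical all_reals all_analysis.
Set Implicit Arguments.
Unset Strict Implicit.
Unset Printing Implicit Defensive.
Import Order.TTheory GRing.Theory Num.Theory.
Import numFieldNormedType.Exports.
Local Open Scope classical_set_scope.
Local Open Scope complex_scope.
Local Open Scope ring_scope.

Section cons_measure.
Variables (R : realType) (m : nat).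
Local Notation mR := (measurableTypeR R).
Variable mu : {sigma_finite_measure set (m.-tuple mR) -> \bar R}.

Definition tcons (x : mR * m.-tuple mR) : m.+1.-tuple mR :=
  [the m.+1.-tuple mR of x.1 :: x.2].

Let measurable_tcons : measurable_fun setT tcons.
Proof. exact: measurable_cons measurable_fst measurable_snd. Qed.

HB.instance Definition _ :=
  isMeasurableFun.Build _ _ _ _ tcons measurable_tcons.

Definition cons_measure : set (m.+1.-tuple mR) -> \bar R :=
  pushforward (@lebesgue_measure R \x mu)%E tcons.

Let cons_measure0 : cons_measure set0 = 0%E.
Proof. exact: measure0. Qed.

Let cons_measure_ge0 A : (0 <= cons_measure A)%E.
Proof. exact: measure_ge0. Qed.

Let cons_measure_sigma_additive : semi_sigma_additive cons_measure.
Proof. exact: measure_semi_sigma_additive. Qed.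

HB.instance Definition _ := isMeasure.Build _ _ _ cons_measure
  cons_measure0 cons_measure_ge0 cons_measure_sigma_additive.

Let cons_measure_sigma_finite : sigma_finite setT cons_measure.
Proof.
have /sigma_finiteP[F [TF ndF Foo]] := sigma_finiteT (@lebesgue_measure R).
have /sigma_finiteP[G [TG ndG Goo]] := sigma_finiteT mu.
pose tl (t : m.+1.-tuple mR) : mR * m.-tuple mR :=
  (thead t, [tuple of behead t]).
have tlK : cancel tl tcons by move=> t; rewrite /tcons /= [RHS]tuple_eta.
have tconsK : cancel tcons tl.
  by case=> a t; rewrite /tl /tcons /=; congr pair; apply: val_inj.
have mtl : measurable_fun setT tl.
  apply/measurable_fun_pairP; split; first exact: measurable_tnth.
  exact: measurable_behead.
exists (fun i => tl @^-1` (F i `*` G i)) => [|i].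
  rewrite -preimage_bigcup (_ : \bigcup_i _ = setT) ?preimage_setT //.
  rewrite -subTset -setXTT TF TG => -[x y] [/= [p _ Fpx] [q _ Gqy]].
  exists (maxn p q) => //; split.
  - by move: x Fpx; exact/subsetPset/ndF/leq_maxl.
  - by move: y Gqy; exact/subsetPset/ndG/leq_maxr.
have [mF Fi] := Foo i; have [mG Gi] := Goo i; split.
  by rewrite -[X in measurable X]setTI; apply: mtl => //; exact: measurableX.
rewrite /cons_measure /pushforward -comp_preimage.
rewrite (_ : tl \o tcons = id) ?preimage_id; last exact/funext.
by rewrite product_measure1E// lte_mul_pinfty// ge0_fin_numE.
Qed.

HB.instance Definition _ := Measure_isSigmaFinite.Build _ _ _ cons_measure
  cons_measure_sigma_finite.

End cons_measure.

Section dirac_tuple0.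
Variable R : realType.
Local Notation mR := (measurableTypeR R).

Definition point_measure : set (0.-tuple mR) -> \bar R :=
  dirac ([tuple] : 0.-tuple mR).

HB.instance Definition _ := FiniteMeasure.on point_measure.

End dirac_tuple0.

Fixpoint lebesgue_tuple (R : realType) (m : nat) :
    {sigma_finite_measure set (m.-tuple (measurableTypeR R)) -> \bar R} :=
  if m is p.+1 then [the {sigma_finite_measure set _ -> \bar R} of
                       cons_measure (lebesgue_tuple R p)]
  else [the {sigma_finite_measure set _ -> \bar R} of @point_measure R].

Section siegel.
Variables (R : realType) (n : nat).
Local Notation C := R[i].
Implicit Types (Z W : 'M[C]_n) (g : 'M[int]_(n + n))
  (Gamma : set 'M[int]_(n + n)) (F H : 'M[C]_n -> C) (k : int).

Definition posdef (Y : 'M[R]_n) : Prop :=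
  Y^T = Y /\ forall v : 'rV[R]_n, v != 0 -> 0 < (v *m Y *m v^T) 0 0.

Definition Immx Z : 'M[R]_n := map_mx (@complex.Im R) Z.

Definition siegel_space : set 'M[C]_n := [set Z | Z^T = Z /\ posdef (Immx Z)].

Definition symplectic_form : 'M[int]_(n + n) :=
  block_mx 0 1%:M (- 1%:M) 0.

Definition siegel_modular_group : set 'M[int]_(n + n) :=
  [set g | g^T *m symplectic_form *m g = symplectic_form].

Definition principal_congruence_subgroup (N : nat) : set 'M[int]_(n + n) :=
  [set g | siegel_modular_group g /\
     forall i j, (g i j = (1%:M : 'M[int]_(n + n)) i j %[mod N%:Z])%Z].

Definition congruence_subgroup Gamma : Prop :=
  [/\ Gamma `<=` siegel_modular_group, Gamma 1%:M,
      (forall g h, Gamma g -> Gamma h -> Gamma (g *m h)),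
      (forall g, Gamma g -> Gamma (invmx g)) &
      exists2 N : nat, (0 < N)%N & principal_congruence_subgroup N `<=` Gamma].

Definition intmx (A : 'M[int]_n) : 'M[C]_n := map_mx intr A.

Definition automorphy_matrix g Z : 'M[C]_n :=
  intmx (dlsubmx g) *m Z + intmx (drsubmx g).

Definition moebius g Z : 'M[C]_n :=
  (intmx (ulsubmx g) *m Z + intmx (ursubmx g)) *m invmx (automorphy_matrix g Z).

Definition slash k g F Z : C :=
  \det (automorphy_matrix g Z) ^ (- k) * F (moebius g Z).

(* Functions on the Siegel space are total functions on matrices of which only
   the values on siegel_space matter.  Composing with the linear projection
   W |-> (W + W^T) / 2 onto the symmetric matrices turns holomorphy in the
   n(n+1)/2 independent entries into complex differentiability on 'M_n. *)
Definition holomorphic F : Prop :=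
  forall Z, siegel_space Z ->
    differentiable (fun W : 'M[C^o]_n => F (2^-1 *: (W + W^T)) : C^o)
      (Z : 'M[C^o]_n).

(* Regularity at the cusps is only required in degree 1: it is automatic in
   higher degree (Koecher). *)
Definition modular_form k Gamma F : Prop :=
  [/\ holomorphic F,
      (forall g, Gamma g ->
         forall Z, siegel_space Z -> slash k g F Z = F Z) &
      (n = 1%N ->
         forall g, siegel_modular_group g -> forall c : R, 0 < c ->
         exists M : R, forall Z, siegel_space Z -> posdef (Immx Z - c%:M) ->
           ComplexField.Normc.normc (slash k g F Z) <= M)].
End siegel.

(* The point diag(Z', it) of the Siegel space of degree n = m + 1. *)
Definition siegel_boundary_path (R : realType) (m n : nat) (e : (m + 1)%N = n)
    (Z' : 'M[R[i]]_m) (t : R) : 'M[R[i]]_n :=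
  castmx (e, e) (block_mx Z' 0 0 (Complex 0 t)%:M).

(* Cusp form: the Siegel operator Phi, (Phi f)(Z') = lim f(diag(Z', it)) as
   t -> +oo, kills F | g for every g in the full modular group. *)
Definition cusp_form (R : realType) (n : nat) (k : int)
    (Gamma : set 'M[int]_(n + n)) (F : 'M[R[i]]_n -> R[i]) : Prop :=
  modular_form k Gamma F /\
  forall g, siegel_modular_group g ->
  forall (m : nat) (e : (m + 1)%N = n) (Z' : 'M[R[i]]_m), siegel_space Z' ->
    slash k g F (siegel_boundary_path e Z' t) @[t --> +oo] --> (0 : R[i]^o).

Section petersson.
Variables (R : realType) (n : nat).
Local Notation C := R[i].
Implicit Types (Z W : 'M[C]_n) (Gamma : set 'M[int]_(n + n))
  (F H G : 'M[C]_n -> C) (k : int).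

(* Coordinates (x_ij, y_ij), i <= j, on the symmetric matrices X + iY. *)
Definition upper_pairs : seq ('I_n * 'I_n) :=
  [seq p : 'I_n * 'I_n <- enum {: 'I_n * 'I_n} | (p.1 <= p.2)%N].

Local Notation coord :=
  ((size upper_pairs).-tuple (measurableTypeR R)).

Definition symmx (v : coord) : 'M[R]_n :=
  \matrix_(i, j) nth 0 v (index (Order.min i j, Order.max i j) upper_pairs).

Definition siegel_point (xy : coord * coord) : 'M[C]_n :=
  \matrix_(i, j) Complex (symmx xy.1 i j) (symmx xy.2 i j).

(* The Euclidean measure dX dY, with dX = prod_(i <= j) dx_ij. *)
Definition dXdY : set (coord * coord) -> \bar R :=
  (lebesgue_tuple R (size upper_pairs) \x lebesgue_tuple R (size upper_pairs))%E.

HB.instance Definition _ := Measure.on dXdY.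

(* A Borel set containing exactly one point of each Gamma-orbit. *)
Definition fundamental_domain Gamma (D : set 'M[C]_n) : Prop :=
  [/\ measurable (siegel_point @^-1` D), D `<=` @siegel_space R n &
      forall Z, siegel_space Z ->
        exists! W, D W /\ exists2 g, Gamma g & W = moebius g Z].

(* A choice of fundamental domain: one exists because Gamma is countable and
   acts properly discontinuously, and integrals of Gamma-invariant functions
   over it do not depend on the choice. *)
Definition a_fundamental_domain Gamma : set 'M[C]_n :=
  xget set0 [set D | fundamental_domain Gamma D].

(* The density det(Y)^-(n+1) of the invariant measure is part of the
   integrand. *)
Definition petersson_integrand k F H Z : C :=
  F Z * conjc (H Z) *
  (\det (Immx Z) ^ k * \det (Immx Z) ^ (- n.+1%:Z))%:C.

Definition petersson Gamma k F H : C :=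
  let D := siegel_point @^-1` a_fundamental_domain Gamma in
  Complex
    (\int[dXdY]_(xy in D)
       complex.Re (petersson_integrand k F H (siegel_point xy)))
    (\int[dXdY]_(xy in D)
       complex.Im (petersson_integrand k F H (siegel_point xy))).

Definition sup_norm k G : \bar R :=
  ereal_sup [set (\det (Immx Z) `^ (k%:~R / 2) *
                  ComplexField.Normc.normc (G Z))%:E | Z in @siegel_space R n].

Definition orthonormal_basis Gamma k (d : nat) (B : 'I_d -> 'M[C]_n -> C) :
    Prop :=
  [/\ (forall i, cusp_form k Gamma (B i)),
      (forall i j, petersson Gamma k (B i) (B j) = (i == j)%:R) &
      forall F, cusp_form k Gamma F ->
        exists c : 'I_d -> C, forall Z, siegel_space Z ->
          F Z = \sum_(i < d) c i * B i Z].

(* sup_Z sum_i det(Y)^k |B_i(Z)|^2 for an orthonormal basis B.  It does not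
   depend on B, so the infimum over B is that common value; a basis exists as
   the space is finite dimensional. *)
Definition sup_cusp_space Gamma k : \bar R :=
  ereal_inf [set s | exists d (B : 'I_d -> 'M[C]_n -> C),
    orthonormal_basis Gamma k B /\
    s = ereal_sup [set (\sum_(i < d) \det (Immx Z) ^ k *
            ComplexField.Normc.normc (B i Z) ^+ 2)%:E | Z in @siegel_space R n]].

End petersson.

Section bounds.
Variables (R : realType) (n : nat).
Implicit Types (Gamma : set 'M[int]_(n + n)) (alpha C : R) (k : int).

Definition cusp_space_bound Gamma alpha C k : Prop :=
  (sup_cusp_space R Gamma k <= (C * k%:~R `^ (2 * alpha))%:E)%E.

Definition normalized_forms_bound Gamma alpha C k : Prop :=
  forall G : 'M[R[i]]_n -> R[i],
    cusp_form k Gamma G -> petersson Gamma k G G = 1 ->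
    (sup_norm k G <= (C * k%:~R `^ alpha)%:E)%E.

End bounds.

(* Main.v *)
Require Import Defs.
From mathcomp Require Import all_boot all_order all_algebra.
From mathcomp Require Import complex.
From mathcomp Require Import all_classical all_reals all_analysis.
From mathcomp Require Import measurable_realfun.
From mathcomp Require Import ring lra.
Import Order.TTheory GRing.Theory Num.Theory.
Import numFieldNormedType.Exports.
Local Open Scope classical_set_scope.
Local Open Scope ring_scope.

(* Let l = kappa0 + 1, so that the weight k l of F = G^l is at least kappa0,
   and put M = det(Y)^k |G|^2.  Expanding F in an orthonormal basis B of weight
   k l, Cauchy-Schwarz gives M^l <= N s, where N = <F, F> and
   s = sup_Z sum_i det(Y)^(k l) |B_i|^2; in particular M <= m, where m^l = N s,
   and no separate proof that a cusp form is bounded is needed.  On the other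
   hand N = int M^l dmu <= m^(l - 1) <G, G> = m^(l - 1).  Hence
   m^l <= m^(l - 1) s, so M <= m <= s. *)

Set Implicit Arguments.
Unset Strict Implicit.
Unset Printing Implicit Defensive.

Local Notation normc := ComplexField.Normc.normc.

(** * Determinants of positive definite matrices *)

Lemma posdef_det_neq0 (R : realType) n (Y : 'M[R]_n) : posdef Y -> \det Y != 0.
Proof.
move=> [_ Ypos]; apply/det0P => -[v v0 vY].
by have := Ypos v v0; rewrite vY mul0mx mxE ltxx.
Qed.

(* [det ((1 - t) I + t Y)] does not vanish for [0 <= t <= 1] and is [1] at
   [t = 0]. *)
Lemma posdef_det_gt0 (R : realType) n (Y : 'M[R]_n) : posdef Y -> 0 < \det Y.
Proof.
move=> Ypd; rewrite lt_def posdef_det_neq0//= leNgt; apply/negP => detY.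
pose P : 'M[{poly R}]_n := (1 - 'X)%:M + 'X *: map_mx polyC Y.
have PE t : (\det P).[t] = \det ((1 - t)%:M + t *: Y).
  rewrite -horner_evalE -det_map_mx; congr (\det _).
  apply/matrixP => i j; rewrite !mxE -[LHS]/(_.[t]).
  by case: (i == j); rewrite ?mulr1n ?mulr0n !hornerE/=.
(* The sign is reversed because [poly_ivt] asks for a value at most [0] on the left and at least [0]
   on the right. *)
have [||t /andP[t0 t1]] := @poly_ivt R (- \det P) 0 1.
- by rewrite ler01.
- rewrite !hornerN !PE !subr0 scale0r addr0 det1 subrr scale1r.
  by rewrite (_ : 0%:M = 0) ?add0r ?oppr_le0 ?ler01 ?oppr_ge0 ?ltW// raddf0.
rewrite /root hornerN oppr_eq0 PE; apply/negP/posdef_det_neq0.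
have [Ysym Ypos] := Ypd; split.
  by rewrite linearD/= linearZ/= tr_scalar_mx Ysym.
move=> v v0; rewrite mulmxDr mul_mx_scalar -scalemxAr mulmxDl -!scalemxAl !mxE.
rewrite [X in _ + t * X]lock.
(* The form at parameter [t] is a convex combination of [v v^T] and [v Y v^T], both positive. *)
have vv : 0 < \sum_j v 0 j * v^T j 0.
  have [j vj] : exists j, v 0 j != 0.
    apply/existsP; apply: contra_neqT v0 => /existsPn v0.
    by apply/rowP => j; rewrite mxE; apply/eqP; have := v0 j; rewrite negbK.
  rewrite (bigD1 j)//= mxE -expr2 ltr_pwDl ?exprn_even_gt0//.
  by apply: sumr_ge0 => i _; rewrite mxE -expr2 sqr_ge0.
have := Ypos v v0; rewrite [X in 0 < X -> _]mxE -lock => vYv.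
nra.
Qed.

(** * Cauchy-Schwarz and the complex modulus *)

(** Lagrange's identity: the double sum of the squares [(a_i b_j - a_j b_i)^2] is twice the
    difference of the two sides. *)
Lemma sum_cauchy_schwarz (R : realDomainType) (I : finType) (a b : I -> R) :
  (\sum_i a i * b i) ^+ 2 <= (\sum_i a i ^+ 2) * (\sum_i b i ^+ 2).
Proof.
have : 0 <= \sum_i \sum_j (a i * b j - a j * b i) ^+ 2.
  by apply: sumr_ge0 => i _; apply: sumr_ge0 => j _; exact: sqr_ge0.
rewrite (_ : \sum_i _ = 2 * ((\sum_i a i ^+ 2) * (\sum_i b i ^+ 2))
                        - 2 * (\sum_i a i * b i) ^+ 2); first lra.
(* Of the two copies of the product, one has its indices swapped, so that the identity holds term by
   term. *)
rewrite expr2 !big_distrlr/= [in X in X - _]mulr_natl mulr2n.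
rewrite [X in _ + X - _]exchange_big/= -big_split/= mulr_sumr -sumrB.
apply: eq_bigr => i _; rewrite -big_split/= mulr_sumr -sumrB.
by apply: eq_bigr => j _; ring.
Qed.

Lemma normc_exp (R : realType) (z : R[i]) m : normc (z ^+ m) = normc z ^+ m.
Proof.
elim: m => [|m IH]; first by rewrite !expr0 ComplexField.Normc.normc1.
by rewrite !exprS ComplexField.Normc.normcM IH.
Qed.

Lemma normc_ge0 (R : realType) (z : R[i]) : 0 <= normc z.
Proof. by case: z => x y; exact: sqrtr_ge0. Qed.

Lemma normc_sqr (R : realType) (z : R[i]) :
  normc z ^+ 2 = complex.Re z ^+ 2 + complex.Im z ^+ 2.
Proof. by case: z => x y; rewrite sqr_sqrtr// addr_ge0// sqr_ge0. Qed.

Lemma normc_sum_cauchy_schwarz (R : realType) (I : finType) (a b : I -> R[i]) :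
  normc (\sum_i a i * b i) ^+ 2 <=
    (\sum_i normc (a i) ^+ 2) * (\sum_i normc (b i) ^+ 2).
Proof.
apply: le_trans (sum_cauchy_schwarz _ _).
rewrite ler_sqr ?nnegrE ?normc_ge0//; last first.
  by apply: sumr_ge0 => i _; rewrite mulr_ge0 ?normc_ge0.
apply: (big_ind2 (fun x y => normc x <= y)) => [|x1 x2 y1 y2 l1 l2|i _].
- by rewrite ComplexField.Normc.normc0.
- by apply: le_trans (le_normcD _ _) _; exact: lerD.
- by rewrite ComplexField.Normc.normcM.
Qed.

(** * Borel measurability of holomorphic functions *)

Definition discretize (R : realType) (p : nat) (x : R) : R :=
  (Num.floor (x * p.+1%:R))%:~R / p.+1%:R.

Lemma discretize_dist (R : realType) (p : nat) (x : R) :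
  `|x - discretize p x| <= p.+1%:R^-1.
Proof.
have p0 : 0 < p.+1%:R :> R by [].
have /andP[l u] := floor_itv (x * p.+1%:R).
rewrite -(ler_pM2r p0) -[X in _ * X](gtr0_norm p0) -normrM mulrBl /discretize.
rewrite mulfVK ?gt_eqF// mulVf ?gt_eqF// ger0_norm ?subr_ge0//.
by rewrite lerBlDl; move: u; rewrite intrD => /ltW.
Qed.

(** The rounded arguments lie in a countable grid, so for any [f] a preimage is a countable union of
    cells on which every [u i] rounds to a given integer. *)
Lemma measurable_fun_discretize d (T : measurableType d) (R : realType)
    (I : finType) (u : I -> T -> R) (f : (I -> R) -> R) (p : nat) :
  (forall i, measurable_fun setT (u i)) ->
  measurable_fun setT (fun x => f (fun i => discretize p (u i x))).
Proof.
move=> mu _ Y mY; rewrite setTI.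
pose cell (z : {ffun I -> int}) : set T :=
  \bigcap_(i in [set: I]) [set x | Num.floor (u i x * p.+1%:R) = z i].
pose value (z : {ffun I -> int}) := f (fun i => (z i)%:~R / p.+1%:R).
rewrite (_ : _ @^-1` Y = \bigcup_z (if value z \in Y then cell z else set0)).
  apply: countable_bigcupT_measurable => [|z]; first exact: countableP.
  case: ifP => // _; apply: fin_bigcap_measurable => // i _.
  have mup : measurable_fun setT (fun x => u i x * p.+1%:R).
    exact: measurable_funM.
  rewrite (_ : [set _ | _] = (fun x => u i x * p.+1%:R) @^-1`
      `[(z i)%:~R, (z i + 1)%:~R[); last first.
    apply/seteqP; split => x /=; rewrite in_itv/=.
      by move=> /eqP; rewrite floor_eq.
    by rewrite -floor_eq => /eqP.
  by rewrite -[X in measurable X]setTI; exact: mup.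
apply/seteqP; split => [x Yx|x [z _]].
  exists [ffun i => Num.floor (u i x * p.+1%:R)] => //.
  rewrite (_ : value _ = f (fun i => discretize p (u i x))).
    by rewrite mem_set// => i _; rewrite /= ffunE.
  by congr f; apply/funext => i; rewrite ffunE.
case: ifPn => // /set_mem Yz zx; rewrite /preimage/=.
rewrite (_ : (fun i => _) = (fun i => (z i)%:~R / p.+1%:R))//.
by apply/funext => i; rewrite /discretize (zx i).
Qed.

(* A function of finitely many real variables is Borel on a set at each point
   of which it is continuous: it is there the limit of its discretizations,
   which take countably many values on measurable cells. *)
Lemma measurable_fun_of_discretize d (T : measurableType d) (R : realType)
    (I : finType) (u : I -> T -> R) (f : (I -> R) -> R) (D : set T) :
  (forall i, measurable_fun setT (u i)) ->
  (forall x, D x ->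
    f (fun i => discretize p (u i x)) @[p --> \oo] --> f (u ^~ x)) ->
  measurable_fun D (fun x => f (u ^~ x)).
Proof.
move=> mu fcvg.
apply: (measurable_fun_cvg
  (h := fun p x => f (fun i => discretize p (u i x)))) => // p.
exact/measurable_funTS/measurable_fun_discretize.
Qed.

Section coordinates.
Variables (R : realType) (n : nat).
Local Notation coord := ((size (upper_pairs n)).-tuple (measurableTypeR R)).

Lemma measurable_symmx i j :
  measurable_fun setT (fun v : coord => symmx v i j).
Proof.
rewrite /symmx; under eq_fun do rewrite mxE.
set k := index _ _; case: (ltnP k (size (upper_pairs n))) => kn.
  rewrite (_ : (fun v : coord => _) = (@tnth _ _ ^~ (Ordinal kn))).
    exact: measurable_tnth.
  by apply/funext => v; rewrite (tnth_nth 0).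
(* Past the end of the list [nth] returns its default [0]. *)
rewrite (_ : (fun v : coord => _) = cst 0); first exact: measurable_cst.
by apply/funext => v; rewrite nth_default// size_tuple.
Qed.

Lemma symmx_sym (v : coord) : (symmx v)^T = symmx v.
Proof. by apply/matrixP => i j; rewrite !mxE minC maxC. Qed.

Lemma siegel_point_sym (xy : coord * coord) :
  (siegel_point xy)^T = siegel_point xy.
Proof.
by apply/matrixP => i j; rewrite !mxE (minC i) (maxC i).
Qed.

Lemma Immx_siegel_point (xy : coord * coord) :
  Immx (siegel_point xy) = symmx xy.2.
Proof. by apply/matrixP => i j; rewrite !mxE. Qed.

End coordinates.

Lemma normc_le_sum (R : realType) (x y : R) :
  normc (Complex x y) <= `|x| + `|y|.
Proof.
rewrite -ler_sqr ?nnegrE ?normc_ge0 ?addr_ge0// normc_sqr/=.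
rewrite -(real_normK (num_real x)) -(real_normK (num_real y)).
by have := mulr_ge0 (normr_ge0 x) (normr_ge0 y); nra.
Qed.

Lemma Re_lipschitz (R : realType) (x y : R[i]) :
  `|complex.Re x - complex.Re y| <= normc (x - y).
Proof.
rewrite -ler_sqr ?nnegrE ?normc_ge0// normc_sqr real_normK ?num_real//.
by case: x y => [a b] [c d]/=; rewrite lerDl sqr_ge0.
Qed.

Lemma Im_lipschitz (R : realType) (x y : R[i]) :
  `|complex.Im x - complex.Im y| <= normc (x - y).
Proof.
rewrite -ler_sqr ?nnegrE ?normc_ge0// normc_sqr real_normK ?num_real//.
by case: x y => [a b] [c d]/=; rewrite lerDr sqr_ge0.
Qed.

(** Radii of balls in matrix spaces over [R[i]] are themselves in [R[i]]; this turns them into real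
    radii. *)
Lemma complex_pos_real (R : realType) (e : R[i]) :
  0 < e -> exists2 r : R, 0 < r & e = (r%:C)%C.
Proof.
by case: e => r s; rewrite ltcE/= => /andP[/eqP-> r0]; exists r.
Qed.

Lemma half_double (R : realType) n (Z : 'M[R[i]]_n) : 2^-1 *: (Z + Z) = Z.
Proof.
suff half (z : R[i]) : 2^-1 * (z + z) = z.
  by apply/matrixP => i j; rewrite !mxE; exact: half.
by field.
Qed.

Section measurable_holomorphic.
Local Open Scope complex_scope.
Variables (R : realType) (n : nat).
Local Notation coord := ((size (upper_pairs n)).-tuple (measurableTypeR R)).

(** Holomorphy makes the symmetrized function [sym] continuous at points of the Siegel space, where
    it agrees with [F]; so its values at rounded coordinates converge. In the applications [phi] is
    the real or the imaginary part. *)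
Lemma measurable_holomorphic (F : 'M[R[i]]_n -> R[i]) (phi : R[i] -> R)
    (D : set (coord * coord)) :
  (forall x y, `|phi x - phi y| <= normc (x - y)) -> holomorphic F ->
  D `<=` @siegel_point R n @^-1` @siegel_space R n ->
  measurable_fun D (fun xy => phi (F (siegel_point xy))).
Proof.
move=> phiL holF DS.
pose u (i : bool * ('I_n * 'I_n)) (xy : coord * coord) : R :=
  symmx (if i.1 then xy.1 else xy.2) i.2.1 i.2.2.
pose mat (w : bool * ('I_n * 'I_n) -> R) : 'M[R[i]^o]_n :=
  \matrix_(i, j) Complex (w (true, (i, j))) (w (false, (i, j))).
pose sym (W : 'M[R[i]^o]_n) : R[i]^o := F (2^-1 *: (W + W^T)).
have symE xy : sym (mat (u ^~ xy)) = F (siegel_point xy).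
  rewrite /sym (_ : mat _ = siegel_point xy); last first.
    by apply/matrixP => i j; rewrite !mxE.
  by rewrite siegel_point_sym half_double.
rewrite (_ : (fun xy => _) = fun xy => phi (sym (mat (u ^~ xy)))); last first.
  by apply/funext => xy; rewrite symE.
apply: (measurable_fun_of_discretize (f := fun w => phi (sym (mat w)))).
  move=> [b [i j]]; rewrite /u/=; case: b.
    exact: (measurableT_comp (@measurable_symmx R n i j) measurable_fst).
  exact: (measurableT_comp (@measurable_symmx R n i j) measurable_snd).
move=> xy Dxy.
pose w p i := discretize p (u i xy).
have cvgmat : mat (w p) @[p --> \oo] --> mat (u ^~ xy).
  apply/cvg_ballP => e /complex_pos_real[r r0 ->].
  near=> p; split=> [|i j]; first by rewrite ltcR.
  rewrite !mxE -ball_normE/=.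
  rewrite (_ : `| _ | = (normc (Complex
    (u (true, (i, j)) xy - w p (true, (i, j)))
    (u (false, (i, j)) xy - w p (false, (i, j)))))%:C)//.
  rewrite ltcR; apply: le_lt_trans (normc_le_sum _ _) _.
  (* Half of the radius goes to the rounding error of the real part and half to that of the
     imaginary part. *)
  have H : p.+1%:R^-1 < r / 2.
    near: p; have /cvgrPdist_lt := @cvg_harmonic R.
    move=> /(_ _ (divr_gt0 r0 (ltr0Sn _ 1))); apply: filterS => p.
    rewrite sub0r normrN /= ger0_norm//.
  rewrite (splitr r) ltrD// (le_lt_trans _ H)//; exact: discretize_dist.
have Z : siegel_space (siegel_point xy) by exact: DS.
have /differentiable_continuous symc := holF _ Z.
have symcvg : sym (mat (w p)) @[p --> \oo] --> sym (mat (u ^~ xy)).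
  apply: (cvg_comp _ _ cvgmat).
  rewrite (_ : mat (u ^~ xy) = siegel_point xy); last first.
    by apply/matrixP => i j; rewrite !mxE.
  exact: symc.
apply/cvgrPdist_lt => e e0.
have /cvgrPdist_lt/(_ e%:C) := symcvg; rewrite ltcR => /(_ e0).
apply: filterS => p.
rewrite (_ : `|_| = (normc (sym (mat (u ^~ xy)) - sym (mat (w p))))%:C)//.
by rewrite ltcR; apply: le_lt_trans; exact: phiL.
Unshelve. all: by end_near.
Qed.

End measurable_holomorphic.

(** * Powers of cusp forms *)

Section cusp_form_exp.
Variables (R : realType) (n : nat).

Lemma slash_exp (k : int) (l : nat) g (F : 'M[R[i]]_n -> R[i]) Z :
  slash (k * l%:Z) g (fun W => F W ^+ l) Z = slash k g F Z ^+ l.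
Proof.
by rewrite /slash exprMn -mulNr; congr (_ * _); rewrite [RHS]exprnP exprz_exp.
Qed.

(** Taking powers commutes with the slash operators once the weight is multiplied by [l], so each
    condition passes to the power. *)
Lemma cusp_form_exp (k : int) (l : nat) Gamma (F : 'M[R[i]]_n -> R[i]) :
  (0 < l)%N -> cusp_form k Gamma F ->
  cusp_form (k * l%:Z) Gamma (fun Z => F Z ^+ l).
Proof.
move=> l0 [[holF invF regF] cuspF]; split; first split.
- move=> Z SZ; case: l l0 => // l _.
  have := differentiableX l (holF Z SZ); rewrite exprfctE; exact.
- by move=> g Gg Z SZ; rewrite slash_exp invF.
- move=> n1 g Sg c c0; have [M FM] := regF n1 g Sg c c0.
  exists (M ^+ l) => Z SZ YZ.
  rewrite slash_exp normc_exp lerXn2r ?nnegrE ?normc_ge0 ?FM//.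
  by rewrite (le_trans _ (FM Z SZ YZ)) ?normc_ge0.
- move=> g Sg m e Z SZ; under eq_fun do rewrite slash_exp.
  have cvg0 := cuspF g Sg m e Z SZ.
  (* The induction starts at exponent [1]: the zeroth power would tend to [1], not to [0]. *)
  case: l l0 => // l _; elim: l => [|l IH]; first exact: cvg0.
  under eq_fun do rewrite exprS.
  by rewrite -(mul0r (0 : R[i])); exact: (@cvgM R[i]  _ _ _ _ _ _ _ cvg0 IH).
Qed.

End cusp_form_exp.

(** * Measurability and integrability of Petersson integrands *)

Section petersson_integrals.
Local Open Scope complex_scope.
Variables (R : realType) (n : nat).
Local Notation coord := ((size (upper_pairs n)).-tuple (measurableTypeR R)).
Local Notation mu := (dXdY (R:=R) (n:=n)).
Implicit Types (F H : 'M[R[i]]_n -> R[i]) (Gamma : set 'M[int]_(n + n)).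

Definition petersson_density (k : int) (Z : 'M[R[i]]_n) : R :=
  \det (Immx Z) ^ k * \det (Immx Z) ^ (- n.+1%:Z).

Definition petersson_domain Gamma : set (coord * coord) :=
  @siegel_point R n @^-1` a_fundamental_domain (R:=R) Gamma.

(** [xget] returns either a genuine fundamental domain or its default [set0], and both claims hold
    in either case. *)
Lemma petersson_domainP Gamma : measurable (petersson_domain Gamma) /\
  petersson_domain Gamma `<=` @siegel_point R n @^-1` @siegel_space R n.
Proof.
rewrite /petersson_domain /a_fundamental_domain.
have [exD|noD] := pselect (exists D, fundamental_domain (R:=R) Gamma D).
  have [mD DS _] := xgetPex set0 exD.
  by split=> // x; exact: DS.
rewrite xgetPN => [|D FD]; last by apply: noD; exists D.
by rewrite preimage_set0.
Qed.

Lemma measurable_petersson_domain Gamma : measurable (petersson_domain Gamma).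
Proof. exact: (petersson_domainP Gamma).1. Qed.

Lemma petersson_domain_sub Gamma :
  petersson_domain Gamma `<=` @siegel_point R n @^-1` @siegel_space R n.
Proof. exact: (petersson_domainP Gamma).2. Qed.

Lemma Re_petersson_integrand k F H Z :
  complex.Re (petersson_integrand k F H Z) =
  (complex.Re (F Z) * complex.Re (H Z) + complex.Im (F Z) * complex.Im (H Z))
  * petersson_density k Z.
Proof.
rewrite /petersson_integrand /petersson_density.
by case: (F Z) (H Z) => a b [c d]/=; rewrite mulr0 subr0 mulrN opprK.
Qed.

Lemma Im_petersson_integrand k F H Z :
  complex.Im (petersson_integrand k F H Z) =
  (complex.Im (F Z) * complex.Re (H Z) - complex.Re (F Z) * complex.Im (H Z))
  * petersson_density k Z.
Proof.
rewrite /petersson_integrand /petersson_density.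
by case: (F Z) (H Z) => a b [c d]/=; rewrite mulr0 add0r mulrN addrC.
Qed.

Lemma Re_petersson_integrand_diag k F Z :
  complex.Re (petersson_integrand k F F Z) =
  normc (F Z) ^+ 2 * petersson_density k Z.
Proof. by rewrite Re_petersson_integrand normc_sqr !expr2. Qed.

Lemma petersson_density_ge0 k Z : siegel_space Z -> 0 <= petersson_density k Z.
Proof.
by move=> [_ /posdef_det_gt0 d0]; rewrite mulr_ge0// exprz_ge0// ltW.
Qed.

Lemma measurable_det_siegel :
  measurable_fun setT (fun xy : coord * coord => \det (Immx (siegel_point xy))).
Proof.
rewrite /determinant; apply: measurable_sum => s.
apply: measurable_funM; first exact: measurable_cst.
apply: measurable_prod => i _; under eq_fun do rewrite Immx_siegel_point.
exact: (measurableT_comp (@measurable_symmx R n i _) measurable_snd).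
Qed.

Lemma measurable_petersson_density k Gamma :
  measurable_fun (petersson_domain Gamma)
    (fun xy => petersson_density k (siegel_point xy)).
Proof.
have mpow m : measurable_fun (petersson_domain Gamma)
    (fun xy => \det (Immx (siegel_point xy)) ^ m).
  (* Positivity of the determinant on the domain lets integer powers, also negative ones, be read as
     the measurable [powR]. *)
  apply: (eq_measurable_fun
    (fun xy => \det (Immx (siegel_point xy)) `^ m%:~R)).
    move=> xy /set_mem/petersson_domain_sub[_ /posdef_det_gt0 d0].
    by rewrite powR_intmul// ltW.
  apply: measurable_funTS.
  exact: (measurableT_comp (measurable_powR m%:~R) measurable_det_siegel).
exact: measurable_funM.
Qed.

Lemma measurable_Re_petersson k Gamma F H : holomorphic F -> holomorphic H ->
  measurable_fun (petersson_domain Gamma)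
    (fun xy => complex.Re (petersson_integrand k F H (siegel_point xy))).
Proof.
move=> hF hH; under eq_fun do rewrite Re_petersson_integrand.
have sub := @petersson_domain_sub Gamma.
apply: measurable_funM; last exact: measurable_petersson_density.
apply: measurable_funD; apply: measurable_funM.
- exact: (measurable_holomorphic (@Re_lipschitz R)).
- exact: (measurable_holomorphic (@Re_lipschitz R)).
- exact: (measurable_holomorphic (@Im_lipschitz R)).
- exact: (measurable_holomorphic (@Im_lipschitz R)).
Qed.

Lemma measurable_Im_petersson k Gamma F H : holomorphic F -> holomorphic H ->
  measurable_fun (petersson_domain Gamma)
    (fun xy => complex.Im (petersson_integrand k F H (siegel_point xy))).
Proof.
move=> hF hH; under eq_fun do rewrite Im_petersson_integrand.
have sub := @petersson_domain_sub Gamma.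
apply: measurable_funM; last exact: measurable_petersson_density.
apply: measurable_funB; apply: measurable_funM.
- exact: (measurable_holomorphic (@Im_lipschitz R)).
- exact: (measurable_holomorphic (@Re_lipschitz R)).
- exact: (measurable_holomorphic (@Re_lipschitz R)).
- exact: (measurable_holomorphic (@Im_lipschitz R)).
Qed.

Definition petersson_integrable k Gamma F H : Prop :=
  mu.-integrable (petersson_domain Gamma)
    (EFin \o (fun xy =>
      complex.Re (petersson_integrand k F H (siegel_point xy))))
  /\
  mu.-integrable (petersson_domain Gamma)
    (EFin \o (fun xy =>
      complex.Im (petersson_integrand k F H (siegel_point xy)))).

(** The integrand is nonnegative, and an infinite integral would be turned into [0] by the
    real-valued integral, against the value [1]. *)
Lemma petersson_normalized_integrable k Gamma F :
  holomorphic F -> petersson Gamma k F F = 1 ->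
  mu.-integrable (petersson_domain Gamma)
    (EFin \o (fun xy =>
      complex.Re (petersson_integrand k F F (siegel_point xy)))).
Proof.
move=> hF /(congr1 (@complex.Re R)) /= F1.
apply/integrableP; split.
  by apply/measurable_EFinP; exact: measurable_Re_petersson.
move: F1; rewrite /Rintegral -/(petersson_domain Gamma).
under [in X in _ -> X]eq_integral => xy /set_mem /petersson_domain_sub S.
  rewrite /= ger0_norm; last first.
    rewrite Re_petersson_integrand_diag mulr_ge0 ?sqr_ge0//.
    exact: petersson_density_ge0.
  over.
by case: (integral _ _ _) => [r _| /esym/eqP|_]; rewrite ?ltry ?ltNyr ?oner_eq0.
Qed.

(** Since [|x y| <= (x^2 + y^2) / 2], both parts of the integrand are dominated by the sum of the
    two diagonal integrands. *)
Lemma petersson_cross_integrable k Gamma F H :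
  holomorphic F -> holomorphic H ->
  petersson Gamma k F F = 1 -> petersson Gamma k H H = 1 ->
  petersson_integrable k Gamma F H.
Proof.
move=> hF hH F1 H1.
have iF := petersson_normalized_integrable hF F1.
have iH := petersson_normalized_integrable hH H1.
have mD := measurable_petersson_domain Gamma.
have iFH := integrableD mD iF iH.
have ab (x y : R) : `|x * y| <= (x ^+ 2 + y ^+ 2) / 2.
  rewrite normrM -(real_normK (num_real x)) -(real_normK (num_real y)).
  by have := sqr_ge0 (`|x| - `|y|); nra.
have ss (z : R[i]) : 0 <= complex.Re z ^+ 2 + complex.Im z ^+ 2.
  by rewrite addr_ge0 ?sqr_ge0.
split; apply: le_integrable iFH => //.
- by apply/measurable_EFinP; exact: measurable_Re_petersson.
- move=> xy /petersson_domain_sub S; rewrite /= lee_fin [leRHS]ger0_norm.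
    rewrite !Re_petersson_integrand_diag Re_petersson_integrand -mulrDl.
    have d0 := petersson_density_ge0 k S.
    rewrite normrM (ger0_norm d0) ler_wpM2r// !normc_sqr.
    apply: le_trans (ler_normD _ _) _.
    apply: le_trans (lerD (ab _ _) (ab _ _)) _.
    have := ss (F (siegel_point xy)); have := ss (H (siegel_point xy)); lra.
  rewrite !Re_petersson_integrand_diag addr_ge0// mulr_ge0 ?sqr_ge0//;
  exact: petersson_density_ge0.
- by apply/measurable_EFinP; exact: measurable_Im_petersson.
- move=> xy /petersson_domain_sub S; rewrite /= lee_fin [leRHS]ger0_norm.
    rewrite !Re_petersson_integrand_diag Im_petersson_integrand -mulrDl.
    have d0 := petersson_density_ge0 k S.
    rewrite normrM (ger0_norm d0) ler_wpM2r// !normc_sqr.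
    apply: le_trans (ler_normB _ _) _.
    apply: le_trans (lerD (ab _ _) (ab _ _)) _.
    have := ss (F (siegel_point xy)); have := ss (H (siegel_point xy)); lra.
  rewrite !Re_petersson_integrand_diag addr_ge0// mulr_ge0 ?sqr_ge0//;
  exact: petersson_density_ge0.
Qed.
End petersson_integrals.

(** * Finite sums of integrals and Parseval's formula *)

Lemma integrable_Rsum d (T : measurableType d) (R : realType)
    (mu : {measure set T -> \bar R}) (D : set T) (I : Type) (s : seq I)
    (h : I -> T -> R) : measurable D ->
  (forall i, mu.-integrable D (EFin \o h i)) ->
  mu.-integrable D (EFin \o (fun x => \sum_(i <- s) h i x)).
Proof.
move=> mD ih.
rewrite (_ : _ \o _ = fun x => (\sum_(i <- s) (EFin \o h i) x)%E).
  exact: integrable_sum.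
by apply/funext => x; rewrite /= sumEFin.
Qed.

Lemma Rintegral_sum d (T : measurableType d) (R : realType)
    (mu : {measure set T -> \bar R}) (D : set T) (I : Type) (s : seq I)
    (h : I -> T -> R) : measurable D ->
  (forall i, mu.-integrable D (EFin \o h i)) ->
  \int[mu]_(x in D) (\sum_(i <- s) h i x) =
    \sum_(i <- s) \int[mu]_(x in D) h i x.
Proof.
move=> mD ih; elim: s => [|i s IH].
  under eq_Rintegral do rewrite big_nil.
  by rewrite Rintegral_cst// mul0r big_nil.
under eq_Rintegral do rewrite big_cons.
by rewrite RintegralD// ?IH ?big_cons//; exact: integrable_Rsum.
Qed.

Section bergman.
Local Open Scope complex_scope.
Variables (R : realType) (n : nat).
Local Notation mu := (dXdY (R:=R) (n:=n)).
Implicit Types (F G : 'M[R[i]]_n -> R[i]) (Gamma : set 'M[int]_(n + n)).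

Lemma Re_sum (I : Type) (s : seq I) (f : I -> R[i]) :
  complex.Re (\sum_(i <- s) f i) = \sum_(i <- s) complex.Re (f i).
Proof. by apply: (big_morph (@complex.Re R)) => // -[a b] [c e]. Qed.

(** [petersson] consists of two real integrals, so the sesquilinear expansion is written as real
    constants times the integrands of these. *)
Lemma petersson_integrand_sum k Z d (c : 'I_d -> R[i])
    (B : 'I_d -> 'M[R[i]]_n -> R[i]) F :
  F Z = \sum_(i < d) c i * B i Z ->
  complex.Re (petersson_integrand k F F Z) =
  \sum_(p : 'I_d * 'I_d)
    (complex.Re (c p.1 * conjc (c p.2)) *
       complex.Re (petersson_integrand k (B p.1) (B p.2) Z) -
     complex.Im (c p.1 * conjc (c p.2)) *
       complex.Im (petersson_integrand k (B p.1) (B p.2) Z)).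
Proof.
move=> FZ; rewrite -(pair_bigA _ (fun i j =>
    complex.Re (c i * conjc (c j)) *
       complex.Re (petersson_integrand k (B i) (B j) Z) -
     complex.Im (c i * conjc (c j)) *
       complex.Im (petersson_integrand k (B i) (B j) Z)))/=.
rewrite /petersson_integrand FZ rmorph_sum/= big_distrlr/= mulr_suml Re_sum.
apply: eq_bigr => i _; rewrite mulr_suml Re_sum; apply: eq_bigr => j _.
rewrite rmorphM/=; set w := (_ * _)%:C.
rewrite (_ : c i * B i Z * _ * w =
  (c i * (c j)^*) * (B i Z * (B j Z)^* * w)); last by ring.
by case: (c i * _) (B i Z * _ * _) => a b [e f].
Qed.

(** The normalization of the basis makes all cross terms integrable; integrating term by term,
    orthogonality leaves the diagonal. *)
Lemma parseval Gamma k d (c : 'I_d -> R[i]) (B : 'I_d -> 'M[R[i]]_n -> R[i]) F :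
  orthonormal_basis Gamma k B ->
  (forall Z, siegel_space Z -> F Z = \sum_(i < d) c i * B i Z) ->
  complex.Re (petersson Gamma k F F) = \sum_(i < d) normc (c i) ^+ 2.
Proof.
move=> [cuspB orthB _] FE; rewrite /= -/(petersson_domain Gamma).
have mD := measurable_petersson_domain (R:=R) Gamma.
have holB i : holomorphic (B i) by have [[]] := cuspB i.
have B1 i : petersson Gamma k (B i) (B i) = 1 by rewrite orthB eqxx.
have BI i j := petersson_cross_integrable (holB i) (holB j) (B1 i) (B1 j).
rewrite (@eq_Rintegral _ _ _ _ _ (fun xy => \sum_(p : 'I_d * 'I_d)
    (complex.Re (c p.1 * conjc (c p.2)) *
       complex.Re (petersson_integrand k (B p.1) (B p.2) (siegel_point xy)) -
     complex.Im (c p.1 * conjc (c p.2)) *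
       complex.Im (petersson_integrand k (B p.1) (B p.2) (siegel_point xy))))).
  rewrite Rintegral_sum//; last first.
    move=> [i j] /=; have [iRe iIm] := BI i j.
    by apply: (integrableB mD (integrableZl mD _ iRe) (integrableZl mD _ iIm)).
  rewrite (eq_bigr (fun p : 'I_d * 'I_d =>
      complex.Re (c p.1 * conjc (c p.2)) * (p.1 == p.2)%:R)); last first.
    move=> [i j] _ /=; have [iRe iIm] := BI i j.
    rewrite RintegralB//;
      [|exact: (integrableZl mD _ iRe)|exact: (integrableZl mD _ iIm)].
    rewrite !RintegralZl//.
    have /(congr1 (@complex.Re R))/= := orthB i j.
    have /(congr1 (@complex.Im R))/= := orthB i j.
    rewrite -!/(petersson_domain Gamma) => -> ->.
    by case: (i == j); rewrite /= !mulr0 subr0.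
  rewrite -(pair_bigA _ (fun i j =>
      complex.Re (c i * conjc (c j)) * (i == j)%:R))/=.
  apply: eq_bigr => i _; rewrite (bigD1 i)//= big1 ?addr0.
    rewrite eqxx mulr1 normc_sqr.
    by case: (c i) => a b /=; rewrite mulrN opprK !expr2.
  by move=> j /negPf; rewrite eq_sym => ->; rewrite mulr0.
move=> xy /set_mem/petersson_domain_sub S.
by apply: petersson_integrand_sum; exact: FE.
Qed.

(** * Comparison with the Bergman kernel in weight [k l] *)

Lemma sup_norm_le_bergman Gamma k (l : nat) G d
    (B : 'I_d -> 'M[R[i]]_n -> R[i]) (s : R) :
  (0 < l)%N -> cusp_form k Gamma G -> petersson Gamma k G G = 1 ->
  orthonormal_basis Gamma (k * l%:Z) B ->
  (forall Z, siegel_space Z ->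
    \sum_(i < d) \det (Immx Z) ^ (k * l%:Z) * normc (B i Z) ^+ 2 <= s) ->
  forall Z, siegel_space Z -> \det (Immx Z) ^ k * normc (G Z) ^+ 2 <= s.
Proof.
move=> l0 cuspG G1 onB Bs Z0 SZ0.
pose M Z := \det (Immx Z) ^ k * normc (G Z) ^+ 2.
have det0 Z : siegel_space Z -> 0 < \det (Immx Z).
  by move=> [_ /posdef_det_gt0].
have detX0 Z j : siegel_space Z -> 0 <= \det (Immx Z) ^ j.
  by move=> SZ; rewrite exprz_ge0 ?ltW ?det0.
have M0 Z : siegel_space Z -> 0 <= M Z.
  by move=> SZ; rewrite mulr_ge0 ?sqr_ge0 ?detX0.
have ME Z : M Z ^+ l = \det (Immx Z) ^ (k * l%:Z) * normc (G Z ^+ l) ^+ 2.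
  by rewrite /M exprMn normc_exp -exprz_exp -exprnP -!exprM mulnC.
have s0 : 0 <= s.
  apply: le_trans (Bs _ SZ0); apply: sumr_ge0 => i _.
  by rewrite mulr_ge0 ?sqr_ge0 ?detX0.
have cuspGl := cusp_form_exp l0 cuspG.
have [_ _ /(_ _ cuspGl)[c cE]] := onB.
have N_E := parseval onB cE; set N := \sum_(i < d) _ in N_E.
have N0 : 0 <= N by apply: sumr_ge0 => i _; exact: sqr_ge0.
(* By [parseval], the squared length [N] of the coefficient vector is the Petersson norm of
   [G^l]. *)
have MN Z : siegel_space Z -> M Z ^+ l <= N * s.
  move=> SZ; rewrite ME cE//.
  apply: (@le_trans _ _ (N *
    \sum_(i < d) \det (Immx Z) ^ (k * l%:Z) * normc (B i Z) ^+ 2)).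
    rewrite -mulr_sumr [leRHS]mulrCA ler_wpM2l ?detX0//.
    exact: normc_sum_cauchy_schwarz.
  by rewrite ler_wpM2l ?Bs.
pose m := (N * s) `^ l%:R^-1.
have m0 : 0 <= m by exact: powR_ge0.
have mE : m ^+ l = N * s.
  by rewrite -powR_mulrn// -powRrM mulVf ?powRr1 ?mulr_ge0// pnatr_eq0 -lt0n.
have Mm Z : siegel_space Z -> M Z <= m.
  by move=> SZ; rewrite -(ler_pXn2r l0) ?nnegrE ?M0// ?mE ?MN.
have N_le : N <= m ^+ l.-1.
  rewrite -N_E /= -/(petersson_domain Gamma).
  have mD := measurable_petersson_domain (R:=R) Gamma.
  have [[holG _ _] _] := cuspG; have [[holGl _ _] _] := cuspGl.
  have iG := petersson_normalized_integrable holG G1.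
  have G1R := congr1 (@complex.Re R) G1.
  rewrite /= -/(petersson_domain Gamma) in G1R.
  (* Here [M^l <= m^(l-1) M] is multiplied by the density of the invariant measure; it serves both
     to dominate the integrand of [G^l] and to bound its integral. *)
  have dens Z : siegel_space Z ->
      complex.Re (petersson_integrand (k * l%:Z)
        (fun W => G W ^+ l) (fun W => G W ^+ l) Z)
      <= m ^+ l.-1 * complex.Re (petersson_integrand k G G Z).
    move=> SZ; rewrite !Re_petersson_integrand_diag /petersson_density.
    rewrite mulrA [X in X * _ <= _]mulrC -ME.
    rewrite [leRHS](_ : _ = m ^+ l.-1 * M Z * \det (Immx Z) ^ (- n.+1%:Z)).
      rewrite ler_wpM2r ?detX0// -[in leLHS](prednK l0) exprSr.
      by rewrite ler_wpM2r ?M0// lerXn2r ?nnegrE ?M0 ?Mm.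
    by rewrite /M; ring.
  have iGl : mu.-integrable (petersson_domain Gamma)
    (EFin \o (fun xy => complex.Re (petersson_integrand (k * l%:Z)
       (fun W => G W ^+ l) (fun W => G W ^+ l) (siegel_point xy)))).
    apply: (le_integrable mD _ _ (integrableZl mD (m ^+ l.-1) iG)).
      by apply/measurable_EFinP; exact: measurable_Re_petersson.
    move=> xy /petersson_domain_sub S; rewrite /= lee_fin ger0_norm.
      by apply: le_trans (ler_norm _); exact: dens.
    rewrite Re_petersson_integrand_diag mulr_ge0 ?sqr_ge0//.
    exact: petersson_density_ge0.
  rewrite -[leRHS]mulr1 -G1R -RintegralZl//; apply: le_Rintegral => //.
    exact: (integrableZl mD (m ^+ l.-1) iG).
  by move=> xy /petersson_domain_sub S; exact: dens.
apply: le_trans (Mm _ SZ0) _.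
(* Cancelling [m^(l-1)] requires [m > 0]; otherwise [m <= 0 <= s]. *)
have [m_gt0|] := ltP 0 m; last by move/le_trans; exact.
rewrite -(@ler_pM2l _ (m ^+ l.-1)) ?exprn_gt0//.
by rewrite -exprSr prednK// mE ler_wpM2r.
Qed.
End bergman.

(** * Explicit constants and the three aspects *)

(** The constant is the square root of [C l^(2 alpha)], which remains of [C (k l)^(2 alpha)] once
    [k^(2 alpha)] is split off. The maximum with [0] covers a negative [C]. *)
Lemma normalized_forms_bound_of_cusp_space (R : realType) (n : nat)
    (Gamma : set 'M[int]_(n + n)) (alpha C : R) (k : int) (l : nat) :
  0 < k -> (0 < l)%N -> cusp_space_bound Gamma alpha C (k * l%:Z) ->
  normalized_forms_bound Gamma alpha
    (Num.sqrt (Num.max 0 C) * l%:R `^ alpha) k.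
Proof.
move=> k0 l0 boundC G cuspG G1; apply: ub_ereal_sup => _ [Z SZ <-].
have det0 : 0 < \det (Immx Z) by case: SZ => _ /posdef_det_gt0.
have GZ : \det (Immx Z) ^ k * normc (G Z) ^+ 2 <=
    C * (k * l%:Z)%:~R `^ (2 * alpha).
  rewrite -lee_fin; apply: le_trans boundC.
  (* The bound is proved for every orthonormal basis and so passes to the infimum. *)
  apply: le_ereal_inf_tmp => _ [d [B [onB ->]]].
  set S := ereal_sup _.
  have SB W : siegel_space W ->
      ((\sum_(i < d)
          \det (Immx W) ^ (k * l%:Z) * normc (B i W) ^+ 2)%:E <= S)%E.
    by move=> SW; apply: ereal_sup_ubound; exists W.
  (* An infinite supremum bounds everything; the value [-oo] is excluded by the point [Z]. *)
  case: S SB => [s SB| |SB]; [|by rewrite leey|by have := SB Z SZ].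
  by rewrite lee_fin; apply: (sup_norm_le_bergman l0 cuspG G1 onB).
rewrite lee_fin -ler_sqr ?nnegrE ?mulr_ge0 ?sqrtr_ge0 ?powR_ge0 ?normc_ge0//.
rewrite exprMn -powR_mulrn ?powR_ge0// -powRrM mulfVK ?pnatr_eq0//.
rewrite (powR_intmul _ (ltW det0)); apply: le_trans GZ _.
have kR : 0 <= k%:~R :> R by rewrite ler0z ltW.
rewrite -mulrA exprMn sqr_sqrtr ?le_max ?lexx// -powRM ?ler0n//.
rewrite -powR_mulrn ?powR_ge0// -powRrM (mulrC alpha).
by rewrite intrM (mulrC k%:~R) ler_wpM2r ?powR_ge0// le_max lexx orbT.
Qed.

(** An integer [k >= n / 2 > 0] is at least [1], so the single exponent [kappa0 + 1] lifts all these
    weights past the threshold. The successor keeps the exponent positive when [kappa0 = 0]. *)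
Lemma half_degree_le_weight (R : realType) (n : nat) (k : int) (kappa0 : nat) :
  (1 <= n)%N -> n%:R / 2 <= k%:~R :> R ->
  0 < k /\ kappa0%:Z <= k * kappa0.+1%:Z.
Proof.
move=> n0 nk.
have k0 : 0 < k.
  by rewrite -(ltr0z R) (lt_le_trans _ nk)// divr_gt0// ltr0n.
split=> //; apply: (@le_trans _ _ kappa0.+1%:Z); first by rewrite lez_nat.
by rewrite ler_peMl.
Qed.

(* The three conjuncts are the weight aspect (Gamma fixed, constants depending
   on Gamma), the level aspect (weight fixed, constants depending on the weight
   but uniform over a family X of congruence subgroups) and the hybrid aspect
   (alpha = 0, constants uniform in both).  alpha and the threshold kappa0 are
   fixed once n is, before any subgroup or weight. *)
Theorem theorem9p2 (R : realType) (n : nat) (hn : (1 <= n)%N)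
    (alpha : R) (halpha : 0 <= alpha) (kappa0 : nat) :
  (forall Gamma : set 'M[int]_(n + n), congruence_subgroup Gamma ->
     (exists C : R, forall kappa : int, kappa0%:Z <= kappa ->
        cusp_space_bound Gamma alpha C kappa) ->
     exists C' : R, forall k : int, n%:R / 2 <= k%:~R :> R ->
        normalized_forms_bound Gamma alpha C' k)
  /\
  (forall X : set (set 'M[int]_(n + n)),
     (forall Gamma, X Gamma -> congruence_subgroup Gamma) ->
     (forall kappa : int, kappa0%:Z <= kappa ->
        exists C : R, forall Gamma, X Gamma ->
        cusp_space_bound Gamma alpha C kappa) ->
     forall k : int, n%:R / 2 <= k%:~R :> R ->
        exists C' : R, forall Gamma, X Gamma ->
        normalized_forms_bound Gamma alpha C' k)
  /\
  (forall X : set (set 'M[int]_(n + n)),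
     (forall Gamma, X Gamma -> congruence_subgroup Gamma) ->
     (exists C : R, forall kappa : int, kappa0%:Z <= kappa ->
        forall Gamma, X Gamma -> cusp_space_bound Gamma 0 C kappa) ->
     exists C' : R, forall k : int, n%:R / 2 <= k%:~R :> R ->
        forall Gamma, X Gamma -> normalized_forms_bound Gamma 0 C' k).
Proof.
have weight k := half_degree_le_weight (k := k) kappa0 hn.
split=> [Gamma _ [C HC]|].
  exists (Num.sqrt (Num.max 0 C) * kappa0.+1%:R `^ alpha) => k /weight[k0 kk].
  exact: normalized_forms_bound_of_cusp_space (HC _ kk).
split=> [X _ HX k /weight[k0 kk]|X _ [C HC]].
  (* Only the weight [k (kappa0 + 1)] enters, so [C] depends on [k] but not on [Gamma]. *)
  have [C HC] := HX _ kk.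
  exists (Num.sqrt (Num.max 0 C) * kappa0.+1%:R `^ alpha) => Gamma XG.
  exact: normalized_forms_bound_of_cusp_space (HC _ XG).
(* The last factor is [1], kept to match the general constant at [alpha = 0]. *)
exists (Num.sqrt (Num.max 0 C) * kappa0.+1%:R `^ 0).
move=> k /weight[k0 kk] Gamma XG.
exact: normalized_forms_bound_of_cusp_space (HC _ kk _ XG).
Qed.
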